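(* Let $$r_1=\tfrac12\left(2+\sqrt7+\sqrt{4\sqrt7+7}\right)\approx 4.41948,$$ $$C'_{num,2}=\frac{256\left(47540907929\sqrt7+29996455428\sqrt{4\sqrt7+7}+11337594468\sqrt{7(4\sqrt7+7)}+125781419483\right)}{49\left(\sqrt7+\sqrt{4\sqrt7+7}+2\right)^9\left(11955\sqrt7+7543\sqrt{4\sqrt7+7}+2851\sqrt{7(4\sqrt7+7)}+31629\right)},$$ $$C'_{num,1}=\frac{24576\left(13278615154497729\sqrt7+8378287352473094\sqrt{4\sqrt7+7}+3166694963897366\sqrt{7(4\sqrt7+7)}+35131913454134511\right)}{7\left(\sqrt7+\sqrt{4\sqrt7+7}\right)^3\left(\sqrt7+\sqrt{4\sqrt7+7}+2\right)^9\left(7157\sqrt7+4515\sqrt{4\sqrt7+7}+1707\sqrt{7(4\sqrt7+7)}+18935\right)^2},$$ $$C'_{den}=\frac{1024\left(159102007\sqrt7+100387151\sqrt{4\sqrt7+7}+37942776\sqrt{7(4\sqrt7+7)}+420944344\right)}{7\left(\sqrt7+\sqrt{4\sqrt7+7}+2\right)^{11}\left(5\sqrt7+3\sqrt{4\sqrt7+7}+\sqrt{7(4\sqrt7+7)}+11\right)}.$$ Define $$R(1,n)=\frac{C'_{num,2}(n-9)r_1^{n-2}+C'_{num,1}r_1^{n-2}}{C'_{den}\,r_1^{n-1}}.$$ Then $R(1,n+1)-R(1,n)=\frac{1}{14}$ for all $n$.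
   Context: Motivation: $R(1,n)$ is the asymptotic approximation, via Bapat's formula $r(1,n)=\det L_n(\{1,n\}|\{1,n\})/\det L_n(1|1)$, to the resistance distance between the two degree-3 end vertices $1$ and $n$ of the straight linear 3-tree on $n$ vertices, whose Laplacian $L_n$ is the $n\times n$ matrix with $-1$ on the first three super- and subdiagonals, $0$ elsewhere off the diagonal, and diagonal $(3,4,5,6,\dots,6,5,4,3)$; here $L(A|B)$ denotes $L$ with rows in $A$ and columns in $B$ deleted. Numerically $C'_{num,2}\approx0.0630896$, $C'_{num,1}\approx0.816459$, $C'_{den}\approx0.199855$. *)

(* Defs.v *)
From Stdlib Require Import Reals ZArith.
Open Scope R_scope.

Definition s7 : R := sqrt 7.
Definition sq : R := sqrt (4 * sqrt 7 + 7).
Definition s7q : R := sqrt (7 * (4 * sqrt 7 + 7)).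

Definition r1 : R := 1 / 2 * (2 + s7 + sq).

Definition Cnum2 : R :=
  (256 * (47540907929 * s7 + 29996455428 * sq + 11337594468 * s7q
          + 125781419483))
  / (49 * (s7 + sq + 2) ^ 9
     * (11955 * s7 + 7543 * sq + 2851 * s7q + 31629)).

Definition Cnum1 : R :=
  (24576 * (13278615154497729 * s7 + 8378287352473094 * sq
            + 3166694963897366 * s7q + 35131913454134511))
  / (7 * (s7 + sq) ^ 3 * (s7 + sq + 2) ^ 9
     * (7157 * s7 + 4515 * sq + 1707 * s7q + 18935) ^ 2).

Definition Cden : R :=
  (1024 * (159102007 * s7 + 100387151 * sq + 37942776 * s7q
           + 420944344))
  / (7 * (s7 + sq + 2) ^ 11 * (5 * s7 + 3 * sq + s7q + 11)).

(* Rasym n is R(1,n).  The shifts n - 9, n - 2, n - 1 are taken in R and Z rather than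
   with truncated subtraction on nat, so that the formula keeps its meaning
   for small n. *)
Definition Rasym (n : nat) : R :=
  (Cnum2 * (INR n - 9) * powerRZ r1 (Z.of_nat n - 2)
   + Cnum1 * powerRZ r1 (Z.of_nat n - 2))
  / (Cden * powerRZ r1 (Z.of_nat n - 1)).

(* Main.v *)
Require Import Defs.
From Stdlib Require Import Reals ZArith.
From Stdlib Require Import Lra Lia.
Open Scope R_scope.

(** The common power of [r1] cancels, so [Rasym] is affine in [n] ([Rasym_affine]). In a difference
    of consecutive values [Cnum1] drops out and the slope [Cnum2 / (Cden * r1)] remains. That it
    equals 1/14 is the algebraic identity [Cnum2_Cden], checked using only the squares of [s7] and
    [sq], since [s7q] is their product. *)

Lemma s7_pos : 0 < s7.
Proof. apply sqrt_lt_R0; lra. Qed.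

Lemma sq_pos : 0 < sq.
Proof. pose proof s7_pos; unfold s7 in *; apply sqrt_lt_R0; lra. Qed.

Lemma s7_sqr : s7 * s7 = 7.
Proof. apply sqrt_sqrt; lra. Qed.

Lemma sq_sqr : sq * sq = 4 * s7 + 7.
Proof. pose proof s7_pos; unfold s7 in *; apply sqrt_sqrt; lra. Qed.

Lemma s7qE : s7q = s7 * sq.
Proof. pose proof s7_pos; unfold s7 in *; apply sqrt_mult; lra. Qed.

Lemma r1_pos : 0 < r1.
Proof. pose proof s7_pos; pose proof sq_pos; unfold r1; lra. Qed.

Lemma Cden_pos : 0 < Cden.
Proof.
pose proof s7_pos; pose proof sq_pos.
assert (0 < s7q) by (rewrite s7qE; apply Rmult_lt_0_compat; assumption).
unfold Cden; apply Rdiv_lt_0_compat; [lra |].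
apply Rmult_lt_0_compat; [| lra].
apply Rmult_lt_0_compat; [lra |].
apply pow_lt; lra.
Qed.

(* Clearing denominators leaves an identity in Q(s7, sq), a field of degree 4 over Q. *)
Lemma Cnum2_Cden : 14 * Cnum2 = Cden * r1.
Proof.
pose proof s7_pos as Hs; pose proof sq_pos as Hq.
pose proof s7_sqr as Es; pose proof sq_sqr as Eq.
unfold Cnum2, Cden, r1; rewrite s7qE.
assert (Hp : 0 < s7 * sq) by (apply Rmult_lt_0_compat; assumption).
set (A := 47540907929 * s7 + _ + _ + _).
set (B := 11955 * s7 + _ + _ + _).
set (E := 159102007 * s7 + _ + _ + _).
set (D := 5 * s7 + _ + _ + _).
(* With T = [s7 + sq + 2], [r1] is T/2; the rational constants and nine powers of T cancel, leaving
   this identity. *)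
assert (H : A * D * (s7 + sq + 2) = B * E) by (unfold A, B, D, E; ring [Es Eq]).
assert (HB : B <> 0) by (unfold B; lra).
assert (HD : D <> 0) by (unfold D; lra).
assert (HT : s7 + sq + 2 <> 0) by lra.
(* Opaque atoms keep [field] from expanding the high powers of T in the radicals. *)
clearbody A B D E.
replace (2 + s7 + sq) with (s7 + sq + 2) by ring.
set (T := s7 + sq + 2) in *; clearbody T.
assert (HA : A = B * E / (D * T)) by (rewrite <- H; field; auto).
rewrite HA; field; auto.
Qed.

(** Exponents live in [Z] and [r1] is nonzero, so the cancellation also covers [n < 2], where
    exponents are negative. *)
Lemma Rasym_affine (n : nat) :
  Rasym n = (Cnum2 * (INR n - 9) + Cnum1) / (Cden * r1).
Proof.
pose proof r1_pos; pose proof Cden_pos.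
unfold Rasym.
replace (Z.of_nat n - 1)%Z with (Z.of_nat n - 2 + 1)%Z by lia.
rewrite powerRZ_add, powerRZ_1 by lra.
pose proof (powerRZ_lt r1 (Z.of_nat n - 2) r1_pos).
field; lra.
Qed.

Theorem theorem14 : forall n : nat, Rasym (n + 1) - Rasym n = 1 / 14.
Proof.
intro n.
pose proof r1_pos; pose proof Cden_pos.
rewrite !Rasym_affine, plus_INR, <- Cnum2_Cden; simpl.
(* The denominators are now [14 * Cnum2]. *)
assert (Cnum2 <> 0).
{ pose proof Cnum2_Cden.
  assert (0 < Cden * r1) by (apply Rmult_lt_0_compat; assumption); lra. }
field; assumption.
Qed.
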